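(* Fix an integer $d \geq 1$. Let $\gamma( t ) = ( t , t^2 ,\dots, t^d)$ parametrize the moment curve in $\mathbb{R}^d$. For any real $p > 0$ with $p \notin 2\mathbb{N}$, there exist $k \in \mathbb{N}$ and $a_0, \dots, a_d \in \mathbb{R}$ such that $$\Big\| 1 + \sum_{i=0}^d |a_i| e(\gamma(k+i) \cdot x) \Big\|_{L^p([0,1]^d)} < \Big\| 1 + \sum_{i=0}^d a_i e(\gamma(k+i) \cdot x) \Big\|_{L^p([0,1]^d)}.$$
   Context: Notation: $e(\theta) := e^{2\pi i \theta}$ for $\theta\in\mathbb{R}$; $\|f\|_{L^p([0,1]^d)} := \big(\int_{[0,1]^d}|f(x)|^p\,dx\big)^{1/p}$ for every real $p>0$; $\mathbb{N}=\{1,2,3,\dots\}$ and $2\mathbb{N}$ is the set of positive even integers. *)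

(* Defs.v *)
From HB Require Import structures.
From mathcomp Require Import all_boot all_order all_algebra.
From mathcomp Require Import complex.
From mathcomp Require Import all_classical all_reals all_analysis.

Set Implicit Arguments.
Unset Strict Implicit.
Unset Printing Implicit Defensive.

Import Order.TTheory GRing.Theory Num.Theory.
Import numFieldNormedType.Exports.

Local Open Scope classical_set_scope.
Local Open Scope ring_scope.

Section Lebesgue_measure_Rd.
Context (R : realType).
Local Open Scope ereal_scope.
Local Notation B := (measurableTypeR R).

Definition tuple_cons (d : nat) (z : B * d.-tuple B) : d.+1.-tuple B :=
  [tuple of z.1 :: z.2].

Definition tuple_uncons (d : nat) (x : d.+1.-tuple B) : B * d.-tuple B :=
  (thead x, [tuple of behead x]).

(* R^d is d.-tuple B with the sigma-algebra generated by the coordinates. Its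
   Lebesgue measure is the d-fold product of lebesgue_measure, transported
   along R * R^d ~ R^(d+1); lebesgueRdX gives its value on product sets. *)
Fixpoint lebesgueRd (d : nat) : set (d.-tuple B) -> \bar R :=
  match d with
  | 0%N => \d_[tuple]
  | d'.+1 =>
      pushforward (@lebesgue_measure R \x @lebesgueRd d') (@tuple_cons d')
  end.

Lemma measurable_tuple_cons d :
  measurable_fun [set: B * d.-tuple B] (@tuple_cons d).
Proof. exact: measurable_cons. Qed.

Lemma measurable_tuple_uncons d :
  measurable_fun [set: d.+1.-tuple B] (@tuple_uncons d).
Proof.
apply/measurable_fun_pairP; split => /=.
  exact: measurable_tnth.
exact: measurable_behead.
Qed.

Lemma tuple_consK d : cancel (@tuple_cons d) (@tuple_uncons d).
Proof. by case=> t x; congr pair; exact/val_inj. Qed.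

Section step.
Variables (d : nat) (mu : {sigma_finite_measure set (d.-tuple B) -> \bar R}).

Let nu := pushforward (@lebesgue_measure R \x mu) (@tuple_cons d).

Let nu0 : nu set0 = 0.
Proof. by rewrite /nu /pushforward preimage_set0 measure0. Qed.

Let nu_ge0 A : 0 <= nu A.
Proof. by rewrite /nu /pushforward; exact: measure_ge0. Qed.

Let nu_sigma_additive : semi_sigma_additive nu.
Proof.
move=> F mF tF mUF; rewrite /nu /pushforward preimage_bigcup.
have mcons := @measurable_tuple_cons d.
apply: measure_semi_sigma_additive.
- by move=> n; rewrite -[X in measurable X]setTI; exact: mcons.
- apply/trivIsetP => /= i j _ _ ij; rewrite -preimage_setI.
  by move/trivIsetP : tF => /(_ _ _ _ _ ij) ->//; rewrite preimage_set0.
- by rewrite -preimage_bigcup -[X in measurable X]setTI; exact: mcons.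
Qed.

#[local] HB.instance Definition _ := isMeasure.Build _ _ _ nu
  nu0 nu_ge0 nu_sigma_additive.

Let nu_sigma_finite : sigma_finite setT nu.
Proof.
have /sigma_finiteP[F [TF ndF Foo]] := sigma_finiteT (@lebesgue_measure R).
have /sigma_finiteP[G [TG ndG Goo]] := sigma_finiteT mu.
exists (fun k => @tuple_uncons d @^-1` (F k `*` G k)).
  rewrite -preimage_bigcup; apply/esym; rewrite -subTset => x _ /=.
  have [n _ Fn] : (\bigcup_n F n) (tuple_uncons x).1 by rewrite -TF.
  have [k _ Gk] : (\bigcup_n G n) (tuple_uncons x).2 by rewrite -TG.
  exists (maxn n k) => //; split.
    by move: Fn; exact/subsetPset/ndF/leq_maxl.
  by move: Gk; exact/subsetPset/ndG/leq_maxr.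
move=> k; have [mF Fk] := Foo k; have [mG Gk] := Goo k; split.
  rewrite -[X in measurable X]setTI; apply: measurable_tuple_uncons => //.
  exact: measurableX.
rewrite /nu /pushforward -comp_preimage.
rewrite (_ : _ \o _ = id) ?preimage_id; last first.
  by apply/funext => z; exact: tuple_consK.
by rewrite product_measure1E// lte_mul_pinfty// ge0_fin_numE.
Qed.

#[local] HB.instance Definition _ := Measure_isSigmaFinite.Build _ _ _ nu
  nu_sigma_finite.

Lemma lebesgueRd_step :
  exists m : {sigma_finite_measure set (d.+1.-tuple B) -> \bar R},
    m = nu :> (set (d.+1.-tuple B) -> \bar R).
Proof. by exists nu. Qed.

End step.

Lemma lebesgueRd_ex d :
  exists m : {sigma_finite_measure set (d.-tuple B) -> \bar R},
    m = @lebesgueRd d :> (set (d.-tuple B) -> \bar R).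
Proof.
elim: d => [|d [m mE]] /=.
  by exists \d_([tuple] : 0.-tuple B).
by rewrite -mE; exact: lebesgueRd_step.
Qed.

Section instances.
Variable d : nat.

Let lebesgueRd0 : @lebesgueRd d set0 = 0.
Proof. by have [m <-] := lebesgueRd_ex d. Qed.

Let lebesgueRd_ge0 A : 0 <= @lebesgueRd d A.
Proof. by have [m <-] := lebesgueRd_ex d. Qed.

Let lebesgueRd_sigma_additive : semi_sigma_additive (@lebesgueRd d).
Proof.
have [m <-] := lebesgueRd_ex d; exact: measure_semi_sigma_additive.
Qed.

HB.instance Definition _ := isMeasure.Build _ _ _ (@lebesgueRd d)
  lebesgueRd0 lebesgueRd_ge0 lebesgueRd_sigma_additive.

Let lebesgueRd_sigma_finite : sigma_finite setT (@lebesgueRd d).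
Proof. have [m <-] := lebesgueRd_ex d; exact: sigma_finiteT. Qed.

HB.instance Definition _ := Measure_isSigmaFinite.Build _ _ _ (@lebesgueRd d)
  lebesgueRd_sigma_finite.

End instances.

Lemma lebesgueRdX d (A : 'I_d -> set B) : (forall i, measurable (A i)) ->
  @lebesgueRd d [set x | forall i, A i (tnth x i)] =
  \prod_(i < d) lebesgue_measure (A i).
Proof.
elim: d A => [|d IH] A mA.
  rewrite big_ord0 /= diracE mem_set// => -[]//.
rewrite big_ord_recl -IH; last by move=> i; exact: mA.
rewrite /= /pushforward.
rewrite (_ : _ @^-1` _ =
    A ord0 `*` [set x | forall i, A (lift ord0 i) (tnth x i)]); last first.
  apply/seteqP; split => -[t x] /=.
    move=> H; split; first by have := H ord0.
    by move=> i; have := H (lift ord0 i); rewrite tnthS.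
  move=> [H0 H] i; case: (unliftP ord0 i) => [j|] ->; last by [].
  by rewrite tnthS.
rewrite product_measure1E//.
rewrite (_ : [set x | _] =
    \bigcap_(i in [set: 'I_d]) ((fun x => tnth x i) @^-1` A (lift ord0 i))).
  apply: fin_bigcap_measurable => // i _.
  by rewrite -[X in measurable X]setTI; exact: measurable_tnth.
by apply/seteqP; split => x /= H i; [move=> _|]; exact: H.
Qed.

End Lebesgue_measure_Rd.

Section Lp_norm_on_the_unit_cube.
Context (R : realType).
Local Open Scope complex_scope.

Definition e (theta : R) : R[i] :=
  cos (2 * pi * theta) +i* sin (2 * pi * theta).

Definition dot (d : nat) (u v : d.-tuple R) : R :=
  \sum_(i < d) tnth u i * tnth v i.

(* Coordinates are indexed from 0, hence the exponent i.+1. *)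
Definition moment_curve (d : nat) (t : R) : d.-tuple R :=
  [tuple t ^+ i.+1 | i < d].

Definition unit_cube (d : nat) : set (d.-tuple (measurableTypeR R)) :=
  [set x | forall i, tnth x i \in `[0, 1]].

(* Lnorm is for real-valued functions on a whole space, so the norm of a
   complex-valued f on the cube is spelled out; normc is the modulus in R. *)
Definition Lp_cube (d : nat) (p : R) (f : d.-tuple R -> R[i]) : \bar R :=
  ((\int[@lebesgueRd R d]_(x in @unit_cube d)
      (ComplexField.Normc.normc (f x) `^ p)%:E) `^ p^-1)%E.

End Lp_norm_on_the_unit_cube.

(* Main.v *)
Require Import Defs.
From mathcomp Require Import all_boot all_order all_algebra.
From mathcomp Require Import complex.
From mathcomp Require Import all_classical all_reals all_analysis.
From mathcomp Require Import measurable_realfun zify ring lra.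

Set Implicit Arguments.
Unset Strict Implicit.
Unset Printing Implicit Defensive.

Import Order.TTheory GRing.Theory Num.Theory.
Import numFieldNormedType.Exports.
Import ComplexField.Normc.

Local Open Scope classical_set_scope.
Local Open Scope complex_scope.
Local Open Scope ring_scope.

(* Take all a_i equal to -r with r > 0 small, let G be the sum of the
   e(gamma(k+i).x), and put q = p/2. Off an error O(r^(n+1)), |1 + rG|^p is
   |S_n(rG)|^2 where S_n is the n-th Taylor polynomial of (1+w)^q, so by
   orthogonality int |1 + rG|^p is, up to O(r^(n+1)),
     J(r) = sum_(s,t <= n) binom(q,s) binom(q,t) r^(s+t) M(s,t),
   where M(s,t) counts the pairs of words (f, g) in {0..d} of lengths s and t
   with sum_j gamma(k + f_j) = sum_j gamma(k + g_j).
   Every linear relation between the gamma(k+i) is a multiple of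
   sum_i lam_i gamma(k+i) = 0, with lam_i the value at 0 of the Lagrange basis
   polynomial at the node k+i. If k is a multiple of every denominator
   prod_(j <> i) (i - j), then the lam_i are integers; they sum to 1, so their
   positive parts sum to m+1 and their negative parts to m, and m grows with k.
   Hence M(s,t) = 0 for odd s+t <= 2m+1 except for {s,t} = {m,m+1}, and
   J(-r) - J(r) is at least
     -2 binom(q,m+1) binom(q,m) M(m+1,m) r^(2m+1) + O(r^(2m+2)),
   where for m > q, q not an integer, the two binomials have opposite signs. *)

(** * Words in {0..d} and their power sums *)

(** The exponents start at 1, so words of different lengths can be related; this is what makes odd
    [s + t] possible. *)
Definition equal_power_sums (d k s t : nat)
    (f : {ffun 'I_s -> 'I_d.+1}) (g : {ffun 'I_t -> 'I_d.+1}) : bool :=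
  [forall l : 'I_d, (\sum_j (k + f j) ^ l.+1 == \sum_j (k + g j) ^ l.+1)%N].

(** Turns a vector of multiplicities into a word. Summing an arbitrary [h] over the letters gives
    the form in which the power sums are evaluated later. *)
Lemma word_with_multiplicities (n s : nat) (c : 'I_n -> nat) :
  s = (\sum_i c i)%N ->
  exists f : {ffun 'I_s -> 'I_n}, forall h : 'I_n -> nat,
    (\sum_j h (f j) = \sum_i c i * h i)%N.
Proof.
move=> sE; pose w := flatten [seq nseq (c i) i | i <- enum 'I_n].
have sum_w h : (\sum_(i <- w) h i = \sum_i c i * h i)%N.
  rewrite /w big_flatten big_map big_enum /=; apply: eq_bigr => i _.
  by rewrite big_nseq iter_addn addn0 mulnC.
have sw : size w == s.
  by rewrite -sum1_size sum_w sE; apply/eqP/eq_bigr => i _; rewrite muln1.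
exists [ffun j => tnth (Tuple sw) j] => h.
rewrite -sum_w -[w]/(val (Tuple sw)) [RHS]big_tuple.
by apply: eq_bigr => j _; rewrite ffunE.
Qed.

Lemma dvdz_horner_sub (p : {poly int}) (z : int) :
  (z %| p.[z] - p.[0])%Z.
Proof.
have /factor_theorem[r] : root (p - p.[0]%:P) 0 by rewrite rootE !hornerE subrr.
rewrite subr0 => /(congr1 (fun q => q.[z])); rewrite !hornerE => ->.
exact: dvdz_mull.
Qed.

(** * Lagrange interpolation at 0 from the nodes k, ..., k+d *)

Section Lagrange_at_zero.
Variables (d k : nat).

Definition node (j : nat) : rat := (k + j)%:R.

Lemma node_inj : injective node.
Proof. by move=> i j /(@mulrIn rat _ _) /addnI; apply; rewrite oner_eq0. Qed.

Definition lagrange0 (i : 'I_d.+1) : rat :=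
  (tnth (lagrange d.+1 node) i : {poly rat}).[0].

(** Differences of nodes are free of [k], so the denominator is the same for every [k]; this allows
    [k] to be chosen as a multiple of it. *)
Lemma lagrange0E i : lagrange0 i =
  (\prod_(j < d.+1 | j != i) - (k + j)%:Z)%:Q /
  (\prod_(j < d.+1 | j != i) (i%:Z - j%:Z))%:Q.
Proof.
rewrite /lagrange0 lagrangeE ?hornerE //; last exact: node_inj.
rewrite mulrC !horner_prod; congr (_ / _).
  rewrite rmorph_prod /=; apply: eq_bigr => j _.
  by rewrite !hornerE /node rmorphN /= -pmulrn.
rewrite rmorph_prod /=; apply: eq_bigr => j _.
rewrite !hornerE /node rmorphB /= -!pmulrn !natrD; ring.
Qed.

Lemma horner0_lagrange (p : {poly rat}) : (size p <= d.+1)%N ->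
  p.[0] = \sum_(i < d.+1) p.[node i] * lagrange0 i.
Proof.
move=> sp; rewrite [in LHS](lagrange_gen (ltn0Sn d) node_inj sp).
by rewrite horner_sum; apply: eq_bigr => i _; rewrite !hornerE.
Qed.

(** Expand [p] in monomials: degrees 1 to d cancel because the power sums agree, and the constant
    term only sees the two lengths. *)
Lemma sum_horner_sub (s t : nat) f g (p : {poly rat}) :
  @equal_power_sums d k s t f g -> (size p <= d.+1)%N ->
  \sum_j p.[node (f j)] - \sum_j p.[node (g j)] = (s%:R - t%:R) * p.[0].
Proof.
move=> /forallP fg sp.
under eq_bigr do rewrite (horner_coef_wide _ sp).
under [X in _ - X]eq_bigr do rewrite (horner_coef_wide _ sp).
rewrite exchange_big [X in _ - X]exchange_big /= -sumrB big_ord_recl /=.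
rewrite [X in _ + X]big1 => [|l _].
  under eq_bigr do rewrite mulr1.
  under [X in _ - X + _]eq_bigr do rewrite mulr1.
  by rewrite addr0 horner_coef0 !sumr_const !card_ord; ring.
rewrite /bump /= -!mulr_sumr -mulrBr /node.
under eq_bigr do rewrite -natrX.
under [X in _ - X]eq_bigr do rewrite -natrX.
by rewrite -!natr_sum (eqP (fg l)) subrr mulr0.
Qed.

(** Rigidity: the i-th Lagrange basis polynomial is the indicator of the i-th node, so summing it
    over a word counts the letter [i]. *)
Lemma count_sub_lagrange0 (s t : nat) f g i :
  @equal_power_sums d k s t f g ->
  (\sum_j (f j == i))%:R - (\sum_j (g j == i))%:R = (s%:R - t%:R) * lagrange0 i.
Proof.
move=> fg; rewrite /lagrange0 -(sum_horner_sub fg); last first.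
  by rewrite (size_lagrange_ (ltn0Sn d) node_inj).
rewrite !natr_sum; congr (_ - _); apply: eq_bigr => j _;
  by rewrite (lagrange_sample (ltn0Sn d) node_inj) eq_sym.
Qed.

End Lagrange_at_zero.

(** * Integral weights and the shortest relation of odd total length *)

Definition node_gap (d : nat) (i : 'I_d.+1) : int :=
  \prod_(j < d.+1 | j != i) (i%:Z - j%:Z).

Lemma node_gap_neq0 d (i : 'I_d.+1) : node_gap i != 0.
Proof.
apply/prodf_neq0 => j ji; rewrite subr_eq0 eqz_nat.
by apply: contra ji => /eqP ij; apply/eqP/val_inj.
Qed.

(* Modulo k the numerator is its value at k = 0, namely the denominator if
   i = 0 and 0 otherwise. *)
Lemma lagrange0_int (d k : nat) (i : 'I_d.+1) :
  (node_gap i %| k%:Z)%Z -> exists z : int, lagrange0 k i = z%:Q.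
Proof.
move=> gk; rewrite lagrange0E -/(node_gap i).
pose q : {poly int} := \prod_(j < d.+1 | j != i) (- ('X + j%:Z%:P)).
have q0 : (node_gap i %| q.[0])%Z.
  have [i0|ine0] := eqVneq i ord0.
    apply/dvdzP; exists 1; rewrite mul1r horner_prod; apply: eq_bigr => j _.
    by rewrite !hornerE i0 sub0r.
  rewrite horner_prod (bigD1 ord0) 1?eq_sym//= hornerN hornerD hornerX.
  by rewrite hornerC addr0 oppr0 mul0r.
have : (node_gap i %| q.[k%:Z])%Z.
  rewrite -(subrK q.[0] q.[_]) rpredD//.
  exact/(dvdz_trans gk)/dvdz_horner_sub.
move=> /dvdzP[z zE]; exists z.
rewrite (_ : \prod_(_ < _ | _) _ = q.[k%:Z]); last first.
  by rewrite horner_prod; apply: eq_bigr => j _; rewrite !hornerE.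
by rewrite zE intrM mulfK// intr_eq0 node_gap_neq0.
Qed.

(** The words [f] and [g] spell the positive and negative parts of the weights. Conversely, the
    letter counts of any related pair differ by [s - t] times the weights, so [s + t] is at least |s
    - t| (2m+1), and [s - t] is nonzero when [s + t] is odd. *)
Lemma extremal_power_sums (d B : nat) : (1 <= d)%N ->
  exists k m : nat, [/\ (1 <= k)%N, (B <= m)%N,
    exists f g, @equal_power_sums d k m.+1 m f g &
    forall s t f g, @equal_power_sums d k s t f g ->
      odd (s + t) -> (s + t <= m.*2.+1)%N ->
      (s = m.+1 /\ t = m) \/ (s = m /\ t = m.+1)].
Proof.
move=> d_gt0; pose P : int := \prod_(i < d.+1) node_gap i.
have P_gt0 : (0 < `|P|)%N.
  by rewrite absz_gt0; apply/prodf_neq0 => i _; exact: node_gap_neq0.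
(* The factor [P] makes all weights integral; the factor [(B * d).+1] gives [B * d <= k], which
   forces [B <= m] once [k <= m * d] is known. *)
pose k := ((B * d).+1 * `|P|)%N.
have /fin_all_exists[lam lamE] (i : 'I_d.+1) : exists z : int, lagrange0 k i = z%:Q.
  apply: lagrange0_int.
  by rewrite /k PoszM dvdz_mull// dvdzE absz_nat -dvdzE /P (bigD1 i)//= dvdz_mulr.
have interp (p : {poly rat}) (sp : (size p <= d.+1)%N) :
    p.[0] = \sum_(i < d.+1) p.[node k i] * (lam i)%:Q.
  by rewrite (horner0_lagrange k sp); apply: eq_bigr => i _; rewrite lamE.
have sum_lam : \sum_i lam i = 1.
  apply/(@intr_inj rat); rewrite rmorph_sum /=.
  transitivity ((1 : {poly rat}).[0]); last by rewrite hornerC.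
  rewrite interp ?size_poly1//.
  by apply: eq_bigr => i _; rewrite hornerC mul1r.
have sum_lam_pow l : (0 < l <= d)%N -> \sum_i lam i * ((k + i) ^ l)%N%:Z = 0.
  move=> /andP[l_gt0 ld]; apply/(@intr_inj rat); rewrite rmorph_sum /=.
  transitivity (('X^l : {poly rat}).[0]).
    rewrite interp ?size_polyXn ?ltnS//; apply: eq_bigr => i _.
    by rewrite hornerXn intrM mulrC /node -natrX.
  by rewrite hornerXn expr0n eqn0Ngt l_gt0.
pose lp (i : 'I_d.+1) := (if (0 <= lam i)%R then `|lam i| else 0)%N.
pose lm (i : 'I_d.+1) := (if (0 <= lam i)%R then 0 else `|lam i|)%N.
have lam_pm i : lam i = (lp i)%:Z - (lm i)%:Z by rewrite /lp /lm; case: ifP; lia.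
have abs_lam i : `|lam i|%N = (lp i + lm i)%N by rewrite /lp /lm; case: ifP; lia.
pose m := (\sum_i lm i)%N.
have sum_lp : m.+1 = (\sum_i lp i)%N.
  have := sum_lam; rewrite (eq_bigr _ (fun i _ => lam_pm i)).
  rewrite sumrB -!(big_morph Posz PoszD (erefl 0%:Z)) -/m; lia.
exists k, m; split.
- by rewrite /k muln_gt0.
- have := sum_lam_pow 1; rewrite d_gt0 => /(_ isT) => e0.
  (* The weights sum to 1 and annihilate the nodes, so k is the sum of -lam_i i, and each term is at
     most [lm i * d]. *)
  have : (k <= m * d)%N.
    suff : k%:Z <= \sum_i (lm i)%:Z * d%:Z.
      by rewrite -mulr_suml -(big_morph Posz PoszD (erefl 0%:Z)) -PoszM lez_nat.
    have -> : k%:Z = \sum_i - lam i * i%:Z.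
      have : \sum_i (lam i * k%:Z + lam i * i%:Z) = 0.
        by rewrite -[RHS]e0; apply: eq_bigr => i _; rewrite expn1 PoszD mulrDr.
      rewrite big_split -mulr_suml sum_lam mul1r => /eqP.
      rewrite addr_eq0 => /eqP ->; rewrite -sumrN.
      by apply: eq_bigr => i _; rewrite mulNr.
    apply: ler_sum => i _; have := ltn_ord i; rewrite ltnS => id.
    rewrite lam_pm; nia.
  have : (B * d <= k)%N by rewrite /k; nia.
  by move=> h1 h2; have := leq_trans h1 h2; rewrite leq_pmul2r.
- have [f fE] := word_with_multiplicities sum_lp.
  have [g gE] := word_with_multiplicities (erefl m).
  exists f, g; apply/forallP => l.
  rewrite (fE (fun i => (k + i) ^ l.+1)%N) (gE (fun i => (k + i) ^ l.+1)%N).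
  have := sum_lam_pow l.+1 (ltn_ord l).
  rewrite (eq_bigr _ (fun i _ => congr1 ( *%R^~ _) (lam_pm i))).
  under eq_bigr do rewrite mulrBl.
  rewrite sumrB => /eqP; rewrite subr_eq0 => /eqP pm; rewrite -eqz_nat.
  rewrite !(big_morph Posz PoszD (erefl 0%:Z)).
  under eq_bigr do rewrite PoszM; under [X in _ == X]eq_bigr do rewrite PoszM.
  exact/eqP.
move=> s t f g fg odd_st le_st.
have cnt i : (\sum_j (f j == i))%N%:Z - (\sum_j (g j == i))%N%:Z = (s%:Z - t%:Z) * lam i.
  apply/(@intr_inj rat); rewrite intrM !intrB /=.
  by have := count_sub_lagrange0 i fg; rewrite lamE.
have tot r (h : {ffun 'I_r -> 'I_d.+1}) : (\sum_i \sum_j (h j == i) = r)%N.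
  rewrite exchange_big /= -[RHS]card_ord -sum1_card; apply: eq_bigr => j _.
  by rewrite (bigD1 (h j))//= eqxx big1 ?addn0// => i /negPf; rewrite eq_sym => ->.
(* Letter by letter, the difference of two counts is at most their sum; summed over all letters, the
   counts give back the lengths. *)
have : (`|s%:Z - t%:Z| * \sum_i (lp i + lm i) <= s + t)%N.
  rewrite -{2}(tot s f) -{2}(tot t g) big_distrr -[X in (_ <= X)%N]big_split /=.
  apply: leq_sum => i _; rewrite -abs_lam -abszM -cnt /=.
  by move: (\sum_j _)%N (\sum_j _)%N => a b; lia.
rewrite big_split -sum_lp -/m /= => h.
have : `|s%:Z - t%:Z|%N = 1%N.
  have : `|s%:Z - t%:Z|%N != 0%N by lia.
  have : (`|s%:Z - t%:Z| * (m.*2.+1) <= m.*2.+1)%N by lia.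
  nia.
nia.
Qed.

(** * Taylor approximation of |1 + w|^(2q) by a squared modulus *)

Section binomial_series.
Variable R : realType.
Implicit Types (q t : R) (w z : R[i]) (n j : nat).

(** The generalised binomial coefficient q(q-1)...(q-j+1)/j! for real q. *)
Definition gbinom q j : R := \prod_(i < j) ((q - i%:R) / i.+1%:R).

Lemma gbinomS q j : gbinom q j.+1 * j.+1%:R = (q - j%:R) * gbinom q j.
Proof. by rewrite /gbinom big_ord_recr /= -mulrA divfK ?pnatr_eq0// mulrC. Qed.

Definition binom_sum q n z : R[i] := \sum_(j < n.+1) (gbinom q j)%:C * z ^+ j.

(** The derivative in t of [binom_sum q n (t%:C * w)]. *)
Definition binom_sum_deriv q n t w : R[i] :=
  \sum_(j < n) (gbinom q j.+1 * j.+1%:R * t ^+ j)%:C * w ^+ j.+1.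

(** The function (1+tw)^q satisfies (1+tw) s' = q w s. For the truncation, the recurrence [gbinomS]
    cancels everything but one term of top degree. *)
Lemma binom_sum_ode q n t w :
  (1 + t%:C * w) * binom_sum_deriv q n t w =
  w * (q%:C * binom_sum q n (t%:C * w)
       - ((q - n%:R) * gbinom q n * t ^+ n)%:C * w ^+ n).
Proof.
elim: n => [|n IH].
  rewrite /binom_sum_deriv /binom_sum big_ord0 big_ord_recl big_ord0 /gbinom.
  by rewrite big_ord0; ring.
rewrite /binom_sum_deriv big_ord_recr /= -/(binom_sum_deriv q n t w) mulrDr IH.
rewrite /binom_sum [in RHS]big_ord_recr /= -/(binom_sum q n (t%:C * w)).
rewrite -gbinomS; have := gbinomS q n.
set b := gbinom q n.+1; set a := gbinom q n => ba.
by rewrite exprMn !rmorphM !rmorphB !rmorphXn /= -[n.+1%:R]natr1 !exprS; ring.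
Qed.

Lemma Re_sum (I : finType) (F : I -> R[i]) :
  complex.Re (\sum_i F i) = \sum_i complex.Re (F i).
Proof. by apply: (big_morph (@complex.Re R)) => [[? ?] [? ?]|]. Qed.

Lemma Im_sum (I : finType) (F : I -> R[i]) :
  complex.Im (\sum_i F i) = \sum_i complex.Im (F i).
Proof. by apply: (big_morph (@complex.Im R)) => [[? ?] [? ?]|]. Qed.


Lemma is_derive_sum_pow (c : nat -> R) n t :
  is_derive t 1 (fun s : R => \sum_(j < n.+1) c j * s ^+ j)
    (\sum_(j < n) c j.+1 * j.+1%:R * t ^+ j).
Proof.
pose p : {poly R} := \sum_(j < n.+1) c j *: 'X^j.
have -> : (fun s : R => \sum_(j < n.+1) c j * s ^+ j) = horner p.
  apply/funext => s; rewrite horner_sum; apply: eq_bigr => j _.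
  by rewrite hornerZ hornerXn.
apply: is_derive_eq; rewrite linear_sum horner_sum big_ord_recl /=.
rewrite derivZ derivXn mulr0n scaler0 horner0 add0r; apply: eq_bigr => j _.
by rewrite derivZ derivXn hornerZ hornerMn hornerXn -mulr_natr -mulrA [_%:R * _]mulrC.
Qed.

Lemma Re_realM (x : R) z : complex.Re (x%:C * z) = x * complex.Re z.
Proof. by case: z => a b /=; rewrite mul0r subr0. Qed.

Lemma Im_realM (x : R) z : complex.Im (x%:C * z) = x * complex.Im z.
Proof. by case: z => a b /=; rewrite mul0r addr0. Qed.

Lemma is_derive_binom_sum_Re q n w t :
  is_derive t 1 (fun s : R => complex.Re (binom_sum q n (s%:C * w)))
    (complex.Re (binom_sum_deriv q n t w)).
Proof.
have := is_derive_sum_pow (fun j => gbinom q j * complex.Re (w ^+ j)) n t.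
congr (is_derive _ _ _ _).
  apply/funext => s; rewrite Re_sum; apply: eq_bigr => j _.
  by rewrite exprMn -rmorphXn mulrA -rmorphM Re_realM mulrAC.
rewrite Re_sum; apply: eq_bigr => j _.
by rewrite Re_realM; ring.
Qed.

Lemma is_derive_binom_sum_Im q n w t :
  is_derive t 1 (fun s : R => complex.Im (binom_sum q n (s%:C * w)))
    (complex.Im (binom_sum_deriv q n t w)).
Proof.
have := is_derive_sum_pow (fun j => gbinom q j * complex.Im (w ^+ j)) n t.
congr (is_derive _ _ _ _).
  apply/funext => s; rewrite Im_sum; apply: eq_bigr => j _.
  by rewrite exprMn -rmorphXn mulrA -rmorphM Im_realM mulrAC.
rewrite Im_sum; apply: eq_bigr => j _.
by rewrite Im_realM; ring.
Qed.


(** The squared modulus without a square root, hence easy to differentiate. *)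
Definition sqnormc z : R := complex.Re z ^+ 2 + complex.Im z ^+ 2.

Lemma normc_ge0 z : 0 <= normc z.
Proof. by case: z => a b; exact: sqrtr_ge0. Qed.

Lemma sqr_normc z : normc z ^+ 2 = sqnormc z.
Proof. by case: z => a b /=; rewrite sqr_sqrtr// addr_ge0// sqr_ge0. Qed.

Lemma normc_powR z q : normc z `^ (2 * q) = sqnormc z `^ q.
Proof. by rewrite -sqr_normc -powR_mulrn ?normc_ge0// -powRrM. Qed.

Lemma normc_real (x : R) : normc x%:C = `|x|.
Proof. by rewrite /= expr0n addr0 sqrtr_sqr. Qed.

Lemma normcX z j : normc (z ^+ j) = normc z ^+ j.
Proof. by elim: j => [|j IH]; rewrite ?normc1// !exprS normcM IH. Qed.

Lemma normr_Re_le z : `|complex.Re z| <= normc z.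
Proof.
case: z => a b /=; rewrite -sqrtr_sqr ler_sqrt ?lerDl ?sqr_ge0//.
by rewrite addr_ge0// sqr_ge0.
Qed.

Lemma normc_sum_le (I : finType) (F : I -> R[i]) :
  normc (\sum_i F i) <= \sum_i normc (F i).
Proof.
elim/big_ind2 : _ => [|x a y b xa yb|//]; first by rewrite normc0.
exact: le_trans (le_normcD _ _) (lerD xa yb).
Qed.

Lemma normcJ z : normc (conjc z) = normc z.
Proof. by case: z => a b /=; rewrite sqrrN. Qed.

(** With c = 1+tw, c' = w and s' = s1, the left side is, up to a positive factor, the derivative of
    |s|^2 |c|^(-2q). Substituting the equation cancels the terms in q and leaves only the remainder
    [k]. *)
Lemma sqnormc_ode (q : R) (c w s s1 k : R[i]) : c * s1 = w * (q%:C * s - k) ->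
  (complex.Re s * complex.Re s1 + complex.Im s * complex.Im s1) * sqnormc c
    - q * sqnormc s * (complex.Re w * complex.Re c + complex.Im w * complex.Im c)
  = - complex.Re (conjc s * conjc c * (w * k)).
Proof.
case: c w s s1 k => [c c'] [w w'] [s s'] [t t'] [k k'] [/= e e'].
rewrite /sqnormc /=.
rewrite (_ : (s * t + s' * t') * (c ^+ 2 + c' ^+ 2) =
  (s * c - s' * c') * (c * t - c' * t') + (s * c' + s' * c) * (c * t' + c' * t)).
  by rewrite e e'; ring.
by ring.
Qed.

Lemma is_derive_sqnormc_affine w t :
  is_derive t 1 (fun s : R => sqnormc (1 + s%:C * w))
    (2 * (complex.Re w * complex.Re (1 + t%:C * w)
          + complex.Im w * complex.Im (1 + t%:C * w))).
Proof.
case: w => u v; rewrite /sqnormc /=.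
by apply: is_derive_eq; rewrite /GRing.scale /=; ring.
Qed.

Lemma half_le_normcD1 w : normc w <= 2^-1 -> 2^-1 <= normc (1 + w).
Proof.
move=> w2; have := le_normcD (1 + w) (- w).
rewrite addrK normc1 normcN; lra.
Qed.

(* Equals 1 at t = 0; by the differential equation satisfied by the truncated
   series, its derivative is O(|w|^(n+1)). *)
Definition binom_ratio q n w t : R :=
  sqnormc (binom_sum q n (t%:C * w)) * sqnormc (1 + t%:C * w) `^ (- q).

Lemma is_derive_binom_ratio q n w t : 0 < sqnormc (1 + t%:C * w) ->
  is_derive t 1 (binom_ratio q n w)
    (- 2 * sqnormc (1 + t%:C * w) `^ (- q - 1) *
     complex.Re (conjc (binom_sum q n (t%:C * w)) * conjc (1 + t%:C * w) *
       (w * (((q - n%:R) * gbinom q n * t ^+ n)%:C * w ^+ n)))).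
Proof.
move=> Q_gt0.
have dA := is_derive_binom_sum_Re q n w t.
have dB := is_derive_binom_sum_Im q n w t.
have dQ := is_derive_sqnormc_affine w t.
have dP := is_derive1_powR (- q) Q_gt0.
have dPQ := is_derive1_comp (f := fun x : R => x `^ (- q))
  (g := fun s : R => sqnormc (1 + s%:C * w)) dP dQ.
have := is_deriveM (is_deriveD (is_deriveX 2 dA) (is_deriveX 2 dB)) dPQ.
congr (is_derive _ _ _ _) => //.
have ode := sqnormc_ode (binom_sum_ode q n t w).
rewrite mulNr -mulrA mulNr -mulrA -mulrN -mulrN -ode /GRing.scale /=.
rewrite -[(_ + _) t]/(sqnormc (binom_sum q n (t%:C * w))).
have -> : sqnormc (1 + t%:C * w) `^ (- q) =
    sqnormc (1 + t%:C * w) `^ (- q - 1) * sqnormc (1 + t%:C * w).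
  rewrite -[X in _ = _ * X]powRr1 ?(ltW Q_gt0)// -powRD ?subrK//.
  by rewrite (gt_eqF Q_gt0) implybT.
ring.
Qed.

(** The mean value theorem for [binom_ratio] on [0,1] compares the two moduli directly, so no branch
    of a complex power is needed. *)
Lemma normc_Taylor q n : 0 <= q ->
  exists2 C : R, 0 <= C & forall w, normc w <= 2^-1 ->
    `| normc (1 + w) `^ (2 * q) - normc (binom_sum q n w) ^+ 2 |
      <= C * normc w ^+ n.+1.
Proof.
move=> q_ge0; pose M : R := \sum_(j < n.+1) `|gbinom q j|.
(* The factors bound, in order, |1+w|^(2q), the constant 2 times |1+cw|^(-2q-2), the truncated
   series, |1+cw|, and the coefficient of the remainder, where c is the mean value point. *)
pose K : R := 4 `^ q *
  (2 * (4^-1 `^ (q + 1))^-1 * (M * 2 * (`|q - n%:R| * `|gbinom q n|))).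
have M_ge0 : 0 <= M by exact: sumr_ge0.
have K_ge0 : 0 <= K.
  by rewrite /K !mulr_ge0 ?invr_ge0 ?powR_ge0.
exists K => // w w2.
have tw2 t : 0 <= t <= 1 -> normc (t%:C * w) <= 2^-1.
  move=> /andP[t0 t1]; rewrite normcM normc_real ger0_norm//.
  by apply: le_trans w2; rewrite ler_piMl// normc_ge0.
have Q4 t : 0 <= t <= 1 -> 4^-1 <= sqnormc (1 + t%:C * w).
  move=> /tw2 /half_le_normcD1; rewrite -sqr_normc => h.
  by rewrite (_ : 4^-1 = 2^-1 ^+ 2 :> R) ?lerXn2r ?nnegrE ?normc_ge0//; field.
have Q_gt0 t : 0 <= t <= 1 -> 0 < sqnormc (1 + t%:C * w).
  by move=> /Q4; apply: lt_le_trans; rewrite invr_gt0.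
pose dratio (t : R) : R := - 2 * sqnormc (1 + t%:C * w) `^ (- q - 1) *
     complex.Re (conjc (binom_sum q n (t%:C * w)) * conjc (1 + t%:C * w) *
       (w * (((q - n%:R) * gbinom q n * t ^+ n)%:C * w ^+ n))).
have dD t (t01 : 0 <= t <= 1) : is_derive t 1 (binom_ratio q n w) (dratio t).
  exact/is_derive_binom_ratio/Q_gt0.
have [||c c01 cE] := @MVT R (binom_ratio q n w) dratio 0 1 ltr01.
- by move=> x; rewrite in_itv /= => /andP[x0 x1]; apply: dD; rewrite !ltW.
- apply: derivable_within_continuous => x; rewrite in_itv /= => x01.
  by have [] := dD x x01.
move: c01; rewrite in_itv /= => /andP[/ltW c0 /ltW c1].
have c01 : 0 <= c <= 1 by rewrite c0.
have D0 : binom_ratio q n w 0 = 1.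
  rewrite /binom_ratio mul0r addr0 /binom_sum big_ord_recl big1 => [|j _].
    rewrite /gbinom big_ord0 expr0 mulr1 addr0 /sqnormc /=.
    by rewrite expr0n expr1n addr0 powR1 mulr1.
  by rewrite expr0n mulr0.
have Q1 : sqnormc (1 + w) <= 4.
  rewrite -sqr_normc (_ : 4 = 2 ^+ 2 :> R); last by ring.
  rewrite lerXn2r ?nnegrE ?normc_ge0//; apply: le_trans (le_normcD _ _) _.
  rewrite normc1; lra.
have Q1_gt0 : 0 < sqnormc (1 + w).
  by have := Q_gt0 1; rewrite mul1r; apply; rewrite ler01 lexx.
have D1 : sqnormc (binom_sum q n w) = sqnormc (1 + w) `^ q * binom_ratio q n w 1.
  rewrite /binom_ratio !mul1r mulrCA powRN divff ?mulr1//.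
  by rewrite gt_eqF// powR_gt0.
rewrite normc_powR sqr_normc D1 -[X in X - _]mulr1 -mulrBr normrM ger0_norm ?powR_ge0//.
rewrite /K -[leRHS]mulrA; apply: ler_pM => //; first exact: powR_ge0.
  by rewrite ge0_ler_powR// nnegrE// ltW.
rewrite distrC -[X in `|_ - X|]D0 cE subr0 mulr1 /dratio !normrM normrN normr_nat.
rewrite -!mulrA ler_pM2l// ger0_norm ?powR_ge0//.
apply: ler_pM; rewrite ?powR_ge0 ?normr_ge0//.
  rewrite -opprD powRN lef_pV2 ?posrE ?powR_gt0 ?invr_gt0 ?Q_gt0//.
  rewrite ge0_ler_powR ?addr_ge0 ?nnegrE ?invr_ge0 ?Q4//.
  by rewrite ltW// Q_gt0.
apply: le_trans (normr_Re_le _) _; rewrite !normcM !normcJ normc_real !normrM normcX.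
apply: ler_pM; rewrite ?mulr_ge0 ?exprn_ge0 ?normc_ge0//.
  apply: le_trans (normc_sum_le _) _; apply: ler_sum => j _.
  rewrite normcM normcX normc_real ler_piMr// exprn_ile1 ?normc_ge0//.
  by apply: le_trans (tw2 _ c01) _; lra.
apply: ler_pM; rewrite ?mulr_ge0 ?exprn_ge0 ?normc_ge0//.
  apply: le_trans (le_normcD _ _) _; rewrite normc1.
  by have := tw2 _ c01; lra.
rewrite normrX [`|c|]ger0_norm// exprS.
rewrite (_ : normc w * _ = c ^+ n *
  (`|q - n%:R| * (`|gbinom q n| * (normc w * normc w ^+ n)))); last by ring.
by rewrite ler_piMl ?exprn_ile1// !mulr_ge0 ?exprn_ge0 ?normc_ge0.
Qed.


End binomial_series.

(** * Integration on the cube and orthogonality of characters *)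

Section integrals_on_the_cube.
Variable R : realType.
Local Notation B := (measurableTypeR R).

Lemma measurable_unit_cube d : measurable (@unit_cube R d).
Proof.
rewrite (_ : @unit_cube R d =
    \bigcap_(i in [set: 'I_d]) ((fun x => tnth x i) @^-1` `[0, 1])).
  apply: fin_bigcap_measurable => // i _.
  by rewrite -[X in measurable X]setTI; exact: measurable_tnth.
by apply/seteqP; split => x /= H i; [move=> _|]; exact: H.
Qed.

Lemma lebesgue_measure_unit_itv : @lebesgue_measure R `[0%R, 1%R] = 1%E.
Proof. by rewrite lebesgue_measure_itv /= lte_fin ltr01 oppr0 adde0. Qed.

Lemma lebesgueRd_unit_cube d : @lebesgueRd R d (@unit_cube R d) = 1%E.
Proof.
have := @lebesgueRdX R d (fun=> [set` `[0%R, 1%R]]) (fun=> measurable_itv _).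
rewrite big1 => [|i _]; first exact.
exact: lebesgue_measure_unit_itv.
Qed.

Lemma bounded_integrable_cube d (f : d.-tuple B -> R) (M : R) :
  measurable_fun setT f -> (forall x, `|f x| <= M) ->
  (@lebesgueRd R d).-integrable (@unit_cube R d) (EFin \o f).
Proof.
move=> mf fM; apply: measurable_bounded_integrable.
- exact: measurable_unit_cube.
- by rewrite [X in (X < _)%E](_ : _ = 1%E) ?ltry//; exact: lebesgueRd_unit_cube.
- exact: measurable_funS mf.
- exists M; split; first exact: num_real.
  by move=> x Mx y _; apply: le_trans (fM y) (ltW Mx).
Qed.

(** Fubini, after transport along [tuple_cons]; boundedness on a set of measure 1 supplies
    integrability. *)
Lemma integral_unit_cubeS d (f : d.+1.-tuple B -> R) (M : R) :
  measurable_fun setT f -> (forall x, `|f x| <= M) ->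
  (\int[@lebesgueRd R d.+1]_(x in @unit_cube R d.+1) (f x)%:E =
   \int[lebesgue_measure]_(t in `[0%R, 1%R])
     \int[@lebesgueRd R d]_(y in @unit_cube R d) (f (tuple_cons (t, y)))%:E)%E.
Proof.
move=> mf fM.
have mcons := @measurable_tuple_cons R d.
have cubeS : @tuple_cons R d @^-1` @unit_cube R d.+1 = `[0, 1] `*` @unit_cube R d.
  apply/seteqP; split => -[t y] /=.
    move=> H; split; first exact: H ord0.
    by move=> i; have := H (lift ord0 i); rewrite tnthS.
  move=> [H0 H] i; case: (unliftP ord0 i) => [j|] ->; last exact: H0.
  by rewrite tnthS.
have mA : measurable (`[0%R, 1%R] `*` @unit_cube R d : set (B * _)).
  by apply: measurableX => //; exact: measurable_unit_cube.
have volA : (@lebesgue_measure R \x @lebesgueRd R d)%E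
    (`[0%R, 1%R] `*` @unit_cube R d) = 1%E.
  rewrite product_measure1E//; last exact: measurable_unit_cube.
  rewrite [X in (_ * X)%E](_ : _ = 1%E); last exact: lebesgueRd_unit_cube.
  rewrite [X in (X * _)%E](_ : _ = 1%E) ?mule1//; exact: lebesgue_measure_unit_itv.
have intA : (@lebesgue_measure R \x @lebesgueRd R d)%E.-integrable
    (`[0%R, 1%R] `*` @unit_cube R d) (EFin \o (f \o @tuple_cons R d)).
  apply: measurable_bounded_integrable => //.
  - by rewrite [X in (X < _)%E](_ : _ = 1%E) ?ltry.
  - apply: measurable_funS (measurableT_comp mf mcons) => //.
  - exists M; split; first exact: num_real.
    by move=> x Mx y _; apply: le_trans (fM _) (ltW Mx).
transitivity (\int[pushforward (@lebesgue_measure R \x @lebesgueRd R d)%E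
    (@tuple_cons R d)]_(x in @unit_cube R d.+1) (f x)%:E)%E; first by [].
rewrite integral_pushforward//; last 3 first.
- exact/measurable_EFinP.
- by rewrite cubeS.
- exact: measurable_unit_cube.
(* Fubini is applied on the whole product space, with the integrand extended by zero off the
   cube. *)
rewrite cubeS integral_mkcond -integral12_prod_meas1; last first.
  by apply: (integrable_mkcond _ _).1 => //; exact: intA.
rewrite [RHS]integral_mkcond; apply: eq_integral => t _.
rewrite /fubini_F patchE; case: ifPn => t01.
  rewrite [RHS]integral_mkcond; apply: eq_integral => y _.
  by rewrite !patchE in_setX t01.
by rewrite integral0_eq// => y _; rewrite patchE in_setX (negbTE t01).
Qed.

Lemma sinD2piz (a : R) (v : int) : sin (a + 2 * pi * v%:~R) = sin a.
Proof.
have nat_case n b : sin (b + 2 * pi * n%:R) = sin b :> R.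
  rewrite (_ : 2 * pi * n%:R = pi *+ 2 *+ n); last first.
    by rewrite -(mulr_natr (pi *+ 2)) -(mulr_natr pi 2); ring.
  exact: (periodicn (@sinD2pi R)).
case: v => n; first exact: nat_case.
by rewrite -(nat_case n.+1); congr sin; rewrite NegzE mulrNz -pmulrn; ring.
Qed.

Lemma integral_cos_unit_itv (a : R) (v : int) :
  (\int[lebesgue_measure]_(t in `[0%R, 1%R]) (cos (a + 2 * pi * (v%:~R * t)))%:E =
   (if v == 0%R then cos a else 0%R)%:E)%E.
Proof.
have [->|v0] := eqVneq v 0.
  under eq_integral do rewrite mul0r mulr0 addr0.
  rewrite integral_cst//= [X in (_ * X)%E](_ : _ = 1%E) ?mule1//.
  exact: lebesgue_measure_unit_itv.
pose c : R := 2 * pi * v%:~R.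
have c0 : c != 0.
  by rewrite mulf_neq0 ?intr_eq0// gt_eqF// mulr_gt0 ?pi_gt0.
pose F (t : R) : R := sin (a + c * t) / c.
have dF (t : R) : is_derive t 1 F (cos (a + 2 * pi * (v%:~R * t))).
  rewrite /F; apply: is_derive_eq.
  by rewrite scaler0 !add0r mul1r /GRing.scale /= [2 * pi * (_ * t)]mulrA -/c; field.
have cc : continuous (fun t : R => cos (a + 2 * pi * (v%:~R * t))).
  move=> t; apply: continuous_comp; last exact: continuous_cos.
  apply: cvgD; first exact: cvg_cst.
  by apply: cvgM; [exact: cvg_cst|apply: cvgM; [exact: cvg_cst|exact: cvg_id]].
have FC : continuous F.
  by move=> t; apply: differentiable_continuous; apply/derivable1_diffP; have [] := dF t.
rewrite (continuous_FTC2 (F := F) ltr01).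
- by rewrite /F mulr1 mulr0 addr0 /c sinD2piz -EFinB subrr.
- exact: continuous_subspaceT.
- split.
  + by move=> t _; have [] := dF t.
  + exact/cvg_at_right_filter/FC.
  + exact/cvg_at_left_filter/FC.
- by move=> t _; rewrite derive1E; have [] := dF t.
Qed.

Lemma measurable_cos_linear d (v : 'I_d -> int) (a : R) :
  measurable_fun [set: d.-tuple B]
    (fun x => cos (a + 2 * pi * \sum_(i < d) ((v i)%:~R * tnth x i)) : R).
Proof.
apply: (@measurableT_comp _ _ _ _ _ _ (@cos R)).
  apply: continuous_measurable_fun; exact: continuous_cos.
refine (@measurable_funD _ _ R _ (fun=> a) (fun x => 2 * pi * _) _ _) => //.
refine (@measurable_funM _ _ R _ (fun=> 2 * pi) (fun x => \sum_(i < d) _) _ _) => //.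
refine (@measurable_sum _ _ R _ _ _ (fun i x => (v i)%:~R * (tnth x i : R)) _) => i.
refine (@measurable_funM _ _ R _ (fun=> (v i)%:~R) (fun x => tnth x i : R) _ _) => //.
exact: measurable_tnth.
Qed.

(** The phase [a] carries the induction on [d]: with the first coordinate fixed, its contribution is
    absorbed into the phase. *)
Lemma integral_cos_unit_cube d (v : 'I_d -> int) (a : R) :
  (\int[@lebesgueRd R d]_(x in @unit_cube R d)
     (cos (a + 2 * pi * \sum_(i < d) ((v i)%:~R * tnth x i)))%:E =
   (if [forall i, v i == 0%R] then cos a else 0%R)%:E)%E.
Proof.
elim: d v a => [|d IH] v a.
  under eq_integral do rewrite big_ord0 mulr0 addr0.
  rewrite integral_cst; last exact: measurable_unit_cube.
  rewrite [X in (_ * X)%E](_ : _ = 1%E) ?mule1; last exact: lebesgueRd_unit_cube.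
  by rewrite (_ : [forall i, _])//; apply/forallP => -[].
rewrite (@integral_unit_cubeS _ _ 1); last 2 first.
- exact: measurable_cos_linear.
- by move=> x; rewrite ler_norml cos_geN1 cos_le1.
transitivity (\int[lebesgue_measure]_(t in `[0%R, 1%R])
    (if [forall i : 'I_d, v (lift ord0 i) == 0%R]
     then cos (a + 2 * pi * ((v ord0)%:~R * t)) else 0%R)%:E)%E.
  apply: eq_integral => t _; rewrite -IH; apply: eq_integral => y _.
  rewrite big_ord_recl mulrDr addrA; congr (cos (_ + _ * _))%:E.
  by apply: eq_bigr => i _; rewrite tnthS.
have -> : [forall i, v i == 0] =
    (v ord0 == 0) && [forall i : 'I_d, v (lift ord0 i) == 0].
  apply/forallP/andP => [v0|[v0 /forallP vl] i].
    by split=> //; apply/forallP.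
  by case: (unliftP ord0 i) => [j|] ->.
case: [forall i : 'I_d, _]; last by rewrite andbF integral0_eq.
by rewrite integral_cos_unit_itv andbT.
Qed.

End integrals_on_the_cube.

(** * Mean values of bounded measurable functions *)

Section mean_value.
Variables (R : realType) (d : nat).
Local Notation B := (measurableTypeR R).
Implicit Types f g : d.-tuple B -> R.

(** Measurability and boundedness are bundled in so that integrability is inherited by sums and
    multiples. As the cube has measure 1, the integral is the mean. *)
Definition has_mean f (y : R) : Prop :=
  [/\ measurable_fun setT f, exists M : R, forall x, `|f x| <= M &
      (\int[@lebesgueRd R d]_(x in @unit_cube R d) (f x)%:E = y%:E)%E].

Lemma has_mean_integrable f y : has_mean f y ->
  (@lebesgueRd R d).-integrable (@unit_cube R d) (EFin \o f).
Proof. by case=> mf [M fM] _; exact: bounded_integrable_cube mf fM. Qed.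

Lemma has_mean_ex f (M : R) : measurable_fun setT f ->
  (forall x, `|f x| <= M) -> exists y, has_mean f y.
Proof.
move=> mf fM; have fi := bounded_integrable_cube mf fM.
exists (fine (\int[@lebesgueRd R d]_(x in @unit_cube R d) (f x)%:E)%E).
split=> //; first by exists M.
by rewrite fineK//; apply: integrable_fin_num fi; exact: measurable_unit_cube.
Qed.

Lemma has_mean_cst (c : R) : has_mean (fun=> c) c.
Proof.
split=> //; first by exists `|c|.
rewrite integral_cst; last exact: measurable_unit_cube.
by rewrite [X in (_ * X)%E](_ : _ = 1%E) ?mule1//; exact: lebesgueRd_unit_cube.
Qed.

Lemma has_meanD f g y z : has_mean f y -> has_mean g z ->
  has_mean (fun x => f x + g x) (y + z).
Proof.
move=> fy gz; have fi := has_mean_integrable fy; have gi := has_mean_integrable gz.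
case: fy gz => mf [M fM] fy [mg [N gN] gz]; split.
- exact: measurable_funD.
- by exists (M + N) => x; apply: le_trans (ler_normD _ _) (lerD _ _).
under eq_integral do rewrite EFinD.
rewrite integralD//; last exact: measurable_unit_cube.
by rewrite fy gz.
Qed.

Lemma has_meanZ (c : R) f y : has_mean f y -> has_mean (fun x => c * f x) (c * y).
Proof.
move=> fy; have fi := has_mean_integrable fy.
case: fy => mf [M fM] fy; split.
- exact: measurable_funM.
- by exists (`|c| * M) => x; rewrite normrM ler_wpM2l.
under eq_integral do rewrite EFinM.
rewrite integralZl//; last exact: measurable_unit_cube.
by rewrite fy.
Qed.

Lemma has_mean_le f g y z : has_mean f y -> has_mean g z ->
  (forall x, f x <= g x) -> y <= z.
Proof.
move=> fy gz fg; have fi := has_mean_integrable fy; have gi := has_mean_integrable gz.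
case: fy gz => _ _ fy [_ _ gz]; rewrite -lee_fin -fy -gz.
apply: le_integral => //; first exact: measurable_unit_cube.
by move=> x _; rewrite lee_fin.
Qed.

Lemma has_mean_sum (I : finType) (f : I -> d.-tuple B -> R) (y : I -> R) :
  (forall i, has_mean (f i) (y i)) ->
  has_mean (fun x => \sum_i f i x) (\sum_i y i).
Proof.
move=> fy; suff h (s : seq I) :
  has_mean (fun x => \sum_(i <- s) f i x) (\sum_(i <- s) y i).
  exact: h.
elim: s => [|i s IH].
  rewrite big_nil (_ : (fun x => _) = fun=> 0); first exact: has_mean_cst.
  by apply/funext => x; rewrite big_nil.
rewrite big_cons (_ : (fun x => _) = fun x => f i x + \sum_(j <- s) f j x).
  exact: has_meanD.
by apply/funext => x; rewrite big_cons.
Qed.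

End mean_value.

(** * Moments of the exponential sum and approximation of its p-th power mean *)

Section exponential_sum.
Variables (R : realType) (d k : nat).
Local Notation B := (measurableTypeR R).
Implicit Types (x : d.-tuple B) (r : R).

Lemma eD (a b : R) : e (a + b) = e a * e b.
Proof. by rewrite /e mulrDr cosD sinD; congr (_ +i* _); ring. Qed.

Lemma e0 : e (0 : R) = 1.
Proof. by rewrite /e mulr0 cos0 sin0. Qed.

Lemma conjc_e (a : R) : conjc (e a) = e (- a).
Proof. by rewrite /e mulrN cosN sinN. Qed.

Lemma normc_e (a : R) : normc (e a) = 1.
Proof. by rewrite /e /= cos2Dsin2 sqrtr1. Qed.

Lemma e_sum (I : finType) (F : I -> R) : \prod_i e (F i) = e (\sum_i F i).
Proof. by rewrite (big_morph (@e R) eD e0). Qed.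

Lemma conjc_sum (I : finType) (F : I -> R[i]) :
  conjc (\sum_i F i) = \sum_i conjc (F i).
Proof. exact: rmorph_sum. Qed.

Definition exp_sum x : R[i] :=
  \sum_(i < d.+1) e (dot (moment_curve d (k + i)%N%:R) x).

Definition freq s (f : {ffun 'I_s -> 'I_d.+1}) (l : 'I_d) : nat :=
  (\sum_j (k + f j) ^ l.+1)%N.

Lemma exp_sumX s x : exp_sum x ^+ s =
  \sum_(f : {ffun 'I_s -> 'I_d.+1}) e (\sum_l (freq f l)%:R * tnth x l).
Proof.
rewrite -[in LHS](card_ord s) -prodr_const bigA_distr_bigA /=.
apply: eq_bigr => f _; rewrite e_sum; congr e.
rewrite /dot exchange_big /=; apply: eq_bigr => l _.
rewrite /freq natr_sum mulr_suml; apply: eq_bigr => j _.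
by rewrite tnth_mktuple natrX.
Qed.

Lemma normc_exp_sum x : normc (exp_sum x) <= d.+1%:R.
Proof.
apply: le_trans (normc_sum_le _) _.
under eq_bigr do rewrite normc_e.
by rewrite sumr_const card_ord.
Qed.

Definition moment (s t : nat) : R :=
  \sum_(f : {ffun 'I_s -> 'I_d.+1}) \sum_(g : {ffun 'I_t -> 'I_d.+1})
    (equal_power_sums k f g)%:R.

Lemma has_mean_cos (v : 'I_d -> int) :
  has_mean (fun x => cos (2 * pi * \sum_l ((v l)%:~R * tnth x l)))
    [forall l, v l == 0]%:R.
Proof.
have mc := measurable_cos_linear v (0 : R).
have ic := integral_cos_unit_cube v (0 : R).
split.
- by under eq_fun do rewrite -[X in cos X]add0r.
- by exists 1 => x; rewrite ler_norml cos_geN1 cos_le1.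
under eq_integral do rewrite -[X in cos X]add0r.
by rewrite ic cos0; case: ifP.
Qed.

(** Expanding over pairs of words gives cosines of integer frequencies; by orthogonality only pairs
    with equal frequencies survive, and each contributes 1. *)
Lemma has_mean_exp_sum s t :
  has_mean (fun x => complex.Re (exp_sum x ^+ s * conjc (exp_sum x ^+ t))) (moment s t).
Proof.
pose v (f : {ffun 'I_s -> 'I_d.+1}) (g : {ffun 'I_t -> 'I_d.+1}) (l : 'I_d) : int :=
  (freq f l)%:Z - (freq g l)%:Z.
rewrite (_ : (fun x => _) = fun x => \sum_f \sum_g
    cos (2 * pi * \sum_l ((v f g l)%:~R * tnth x l))).
  apply: has_mean_sum => f; apply: has_mean_sum => g.
  have := has_mean_cos (v f g); congr (has_mean _ _%:R).
  by congr nat_of_bool; apply: eq_forallb => l; rewrite subr_eq0 eqz_nat.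
apply/funext => x; rewrite !exp_sumX conjc_sum big_distrl Re_sum.
apply: eq_bigr => f _; rewrite big_distrr Re_sum; apply: eq_bigr => g _.
rewrite conjc_e -[X in complex.Re X]/(_ * _) -eD; congr (cos (_ * _)); rewrite -sumrB.
by apply: eq_bigr => l _; rewrite /v rmorphB /= mulrBl.
Qed.

Lemma sqnormcE (z : R[i]) : sqnormc z = complex.Re (z * conjc z).
Proof. by case: z => a b; rewrite /sqnormc /=; ring. Qed.

Lemma sqnormc_sum n (c : nat -> R) (z : R[i]) :
  sqnormc (\sum_(s < n) (c s)%:C * z ^+ s) =
  \sum_(s < n) \sum_(t < n) (c s * c t) * complex.Re (z ^+ s * conjc (z ^+ t)).
Proof.
rewrite sqnormcE conjc_sum big_distrl Re_sum; apply: eq_bigr => s _.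
rewrite big_distrr Re_sum; apply: eq_bigr => t _ /=.
have -> : conjc ((c t)%:C * z ^+ t) = (c t)%:C * conjc (z ^+ t).
  by case: (z ^+ t) => a b /=; congr (_ +i* _); ring.
by rewrite -Re_realM rmorphM; congr complex.Re; ring.
Qed.

(** The J(r) of the opening comment, with [moment] as M(s,t). *)
Definition model_mean (q : R) (n : nat) (r : R) : R :=
  \sum_(s < n.+1) \sum_(t < n.+1)
    (gbinom q s * gbinom q t * r ^+ (s + t)) * moment s t.

Lemma has_mean_binom_sum q n r :
  has_mean (fun x => normc (binom_sum q n (r%:C * exp_sum x)) ^+ 2)
    (model_mean q n r).
Proof.
rewrite (_ : (fun x => _) = fun x => \sum_(s < n.+1) \sum_(t < n.+1)
    (gbinom q s * gbinom q t * r ^+ (s + t)) *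
    complex.Re (exp_sum x ^+ s * conjc (exp_sum x ^+ t))).
  apply: has_mean_sum => s; apply: has_mean_sum => t.
  exact/has_meanZ/has_mean_exp_sum.
apply/funext => x; rewrite sqr_normc.
transitivity (sqnormc (\sum_(s < n.+1) (gbinom q s * r ^+ s)%:C * exp_sum x ^+ s)).
  by congr sqnormc; apply: eq_bigr => s _; rewrite exprMn mulrA -rmorphXn -rmorphM.
rewrite (sqnormc_sum _ (fun s => gbinom q s * r ^+ s)).
apply: eq_bigr => s _; apply: eq_bigr => t _.
by rewrite exprD; ring.
Qed.

Lemma measurable_normc_powR (p r : R) :
  measurable_fun [set: d.-tuple B] (fun x => normc (1 + r%:C * exp_sum x) `^ p).
Proof.
(* The squared modulus of 1 + rG is a finite sum of functions already known to be measurable. *)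
rewrite (_ : (fun x => _) = (fun y => y `^ (p / 2)) \o
    (fun x => \sum_(s < 2) \sum_(t < 2) (r ^+ s * r ^+ t) *
      complex.Re (exp_sum x ^+ s * conjc (exp_sum x ^+ t)))).
  apply: measurableT_comp; first exact: measurable_powR.
  have [] // : has_mean (fun x => \sum_(s < 2) \sum_(t < 2) (r ^+ s * r ^+ t) *
      complex.Re (exp_sum x ^+ s * conjc (exp_sum x ^+ t)))
      (\sum_(s < 2) \sum_(t < 2) (r ^+ s * r ^+ t) * moment s t).
  apply: has_mean_sum => s; apply: has_mean_sum => t.
  exact/has_meanZ/has_mean_exp_sum.
apply/funext => x /=.
rewrite -(sqnormc_sum _ (fun s => r ^+ s)) -normc_powR.
rewrite [2 * (p / 2)]mulrC divfK ?pnatr_eq0//.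
by rewrite !big_ord_recl big_ord0 /= /bump /= !expr0 !expr1 mulr1 addr0.
Qed.

(** Since |G| is at most d+1, the Taylor bound at w = rG is uniform in [x] and passes to the means.
    The constant [K] serves both signs of [r]. *)
Lemma mean_powR_approx (p : R) (n : nat) : 0 < p ->
  exists2 K : R, 0 <= K & forall r, `|r| * d.+1%:R <= 2^-1 -> exists y : R,
    has_mean (fun x => normc (1 + r%:C * exp_sum x) `^ p) y /\
    `|y - model_mean (p / 2) n r| <= K * `|r| ^+ n.+1.
Proof.
move=> p_gt0.
have q_ge0 : 0 <= p / 2 by rewrite divr_ge0// ltW.
have [C C_ge0 CT] := normc_Taylor n q_ge0.
exists (C * d.+1%:R ^+ n.+1) => [|r rd]; first by rewrite mulr_ge0// exprn_ge0.
have rG x : normc (r%:C * exp_sum x) <= `|r| * d.+1%:R.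
  by rewrite normcM normc_real ler_wpM2l// normc_exp_sum.
have [y my] : exists y, has_mean (fun x => normc (1 + r%:C * exp_sum x) `^ p) y.
  apply: (has_mean_ex (M := 2 `^ p)) => [|x]; first exact: measurable_normc_powR.
  rewrite ger0_norm ?powR_ge0// ge0_ler_powR ?nnegrE ?normc_ge0// ?(ltW p_gt0)//.
  apply: le_trans (le_normcD _ _) _; rewrite normc1.
  by have := le_trans (rG x) rd; lra.
exists y; split=> //.
have mJ := has_mean_binom_sum (p / 2) n r.
have close x : `|normc (1 + r%:C * exp_sum x) `^ p -
    normc (binom_sum (p / 2) n (r%:C * exp_sum x)) ^+ 2| <=
    C * d.+1%:R ^+ n.+1 * `|r| ^+ n.+1.
  have := CT _ (le_trans (rG x) rd).
  rewrite [2 * (p / 2)]mulrC divfK ?pnatr_eq0// => /le_trans; apply.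
  rewrite -mulrA ler_wpM2l// -exprMn [d.+1%:R * _]mulrC.
  by rewrite lerXn2r ?nnegrE ?normc_ge0 ?mulr_ge0 ?rG.
set L := C * _ * _ in close *.
rewrite ler_distl; apply/andP; split.
  rewrite lerBlDr; apply: (has_mean_le mJ (has_meanD my (has_mean_cst _ L))) => x.
  by have := close x; rewrite ler_distl => /andP[]; rewrite lerBlDr.
apply: (has_mean_le my (has_meanD mJ (has_mean_cst _ L))) => x.
by have := close x; rewrite ler_distl => /andP[].
Qed.

Lemma moment_ge0 s t : 0 <= moment s t.
Proof. by do 2 (apply: sumr_ge0 => ? _); exact: ler0n. Qed.

Lemma moment_gt0 s t f g : @equal_power_sums d k s t f g -> 0 < moment s t.
Proof.
move=> fg; rewrite /moment (bigD1 f)//= (bigD1 g)//= fg.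
rewrite ltr_wpDr ?ltr_wpDr ?ltr01//; last by apply: sumr_ge0 => ? _; exact: ler0n.
by do 2 (apply: sumr_ge0 => ? _); exact: ler0n.
Qed.

Lemma moment_eq0 s t :
  (forall f g, ~~ @equal_power_sums d k s t f g) -> moment s t = 0.
Proof.
move=> nfg; apply: big1 => f _; apply: big1 => g _.
by rewrite (negbTE (nfg f g)).
Qed.

End exponential_sum.

(** * Sign of the leading odd term *)

Section sign.
Variable R : realType.

Lemma gbinom_neq0 (q : R) j : (forall i, (i < j)%N -> q != i%:R) -> gbinom q j != 0.
Proof.
move=> qi; apply/prodf_neq0 => i _.
by rewrite mulf_neq0 ?subr_eq0 ?qi// invr_eq0 pnatr_eq0.
Qed.

(** By [gbinomS] the product is (q - m)/(m+1) times a nonzero square. *)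
Lemma gbinom_alternate (q : R) m : (forall i, q != i%:R) -> q < m%:R ->
  gbinom q m.+1 * gbinom q m < 0.
Proof.
move=> qi qm; have := gbinomS q m; have := gbinom_neq0 (fun i _ => qi i) (j := m).
set b := gbinom q m; set b' := gbinom q m.+1 => b0 b'E.
have : b' * b * m.+1%:R < 0.
  rewrite mulrAC b'E -mulrA -expr2 nmulr_rlt0 ?subr_lt0//.
  by rewrite exprn_even_gt0.
by rewrite pmulr_llt0.
Qed.

(** Terms with [s + t] even cancel, and those of order above 2m+1 go into the error since [r <= 1].
    Among the remaining ones only (m+1, m) and (m, m+1) have a nonzero moment; the first supplies
    [c]. *)
Lemma model_mean_gap (d k m : nat) (q : R) :
  (forall i, q != i%:R) -> q < m%:R ->
  (exists f g, @equal_power_sums d k m.+1 m f g) ->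
  (forall s t f g, @equal_power_sums d k s t f g ->
    odd (s + t) -> (s + t <= m.*2.+1)%N ->
    (s = m.+1 /\ t = m) \/ (s = m /\ t = m.+1)) ->
  exists c K : R, [/\ 0 < c, 0 <= K & forall r, 0 <= r <= 1 ->
    c * r ^+ m.*2.+1 - K * r ^+ m.*2.+2 <=
    model_mean d k q m.*2.+1 (- r) - model_mean d k q m.*2.+1 r].
Proof.
move=> qi qm [f0 [g0 fg0]] rig.
have bb := gbinom_alternate qi qm.
pose c : R := - 2 * (gbinom q m.+1 * gbinom q m) * moment R d k m.+1 m.
pose K s t : R := 2 * `|gbinom q s * gbinom q t| * moment R d k s t.
have K_ge0 s t : 0 <= K s t by rewrite !mulr_ge0 ?moment_ge0.
exists c, (\sum_(s < m.*2.+2) \sum_(t < m.*2.+2) K s t); split.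
- by rewrite mulr_gt0 ?(moment_gt0 _ fg0)// nmulr_rgt0 ?bb//; lra.
- by do 2 (apply: sumr_ge0 => ? _).
move=> r /andP[r0 r1].
(* The main term becomes a double sum supported at (m+1, m), so that the inequality can be checked
   term by term. *)
have -> : c * r ^+ m.*2.+1 = \sum_(s < m.*2.+2) \sum_(t < m.*2.+2)
    (if (s == m.+1 :> nat) && (t == m :> nat) then c * r ^+ m.*2.+1 else 0).
  have ms : (m.+1 < m.*2.+2)%N by rewrite !ltnS -addnn leq_addr.
  have mt : (m < m.*2.+2)%N by apply: ltn_trans ms.
  rewrite (bigD1 (Ordinal ms))//= [X in _ + X]big1 => [|s].
    rewrite addr0 (bigD1 (Ordinal mt))//= !eqxx big1 ?addr0// => t.
    by rewrite -val_eqE /= => /negbTE ->.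
  by rewrite -val_eqE /= => /negbTE ->; apply: big1.
rewrite /model_mean -sumrB mulr_suml -sumrB; apply: ler_sum => s _.
rewrite -sumrB mulr_suml -sumrB; apply: ler_sum => t _.
rewrite -mulrBl -mulrBr.
have [odd_st|even_st] := boolP (odd (s + t)); last first.
  rewrite exprNn -signr_odd (negbTE even_st) expr0 mul1r subrr mulr0 mul0r.
  case: ifP => [/andP[/eqP sE /eqP tE]|_].
    by move: even_st; rewrite sE tE addSn addnn /= odd_double.
  by rewrite sub0r oppr_le0 mulr_ge0// exprn_ge0.
have -> : (- r) ^+ (s + t) - r ^+ (s + t) = - 2 * r ^+ (s + t).
  by rewrite exprNn -signr_odd odd_st expr1; ring.
have [st_le|st_gt] := leqP (s + t) m.*2.+1; last first.
  case: ifP => [/andP[/eqP sE /eqP tE]|_].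
    by move: st_gt; rewrite sE tE addSn addnn ltnn.
  rewrite sub0r.
  have rle : r ^+ (s + t) <= r ^+ m.*2.+2 by rewrite ler_wiXn2l.
  have : `|gbinom q s * gbinom q t * (- 2 * r ^+ (s + t)) * moment R d k s t|
      <= K s t * r ^+ m.*2.+2.
    rewrite !normrM normrN normr_nat (ger0_norm (moment_ge0 _ _ _ _ _)).
    rewrite (ger0_norm (exprn_ge0 _ r0)) /K normrM.
    set a := `|_|; set b := `|_|; set M := moment _ _ _ _ _.
    rewrite (_ : _ * M = 2 * (a * b) * M * r ^+ (s + t)); last by ring.
    by rewrite ler_wpM2l// !mulr_ge0// ?normr_ge0// moment_ge0.
  by rewrite ler_norml => /andP[].
have st_eq : (s = m.+1 :> nat /\ t = m :> nat) \/ (s = m :> nat /\ t = m.+1 :> nat) ->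
    (s + t = m.*2.+1)%N.
  by case=> -[-> ->]; rewrite ?addnS ?addSn addnn.
have Kr_ge0 : 0 <= K s t * r ^+ m.*2.+2 by rewrite mulr_ge0// exprn_ge0.
case: ifP => [/andP[/eqP sE /eqP tE]|nst].
  rewrite sE tE addSn addnn /c -subr_ge0; move: Kr_ge0; rewrite sE tE.
  set X := K _ _ * _ => X_ge0; rewrite (_ : _ - _ = X)//; ring.
rewrite sub0r; apply: (@le_trans _ _ 0); first by rewrite oppr_le0.
(* The mirror pair contributes with the favourable sign and is bounded below by 0. *)
have [e|ne] := boolP ((s == m :> nat) && (t == m.+1 :> nat)).
  have [/eqP -> /eqP ->] := andP e.
  rewrite mulr_ge0 ?moment_ge0// mulrA mulr_ge0 ?exprn_ge0//.
  rewrite [gbinom q m * _]mulrC nmulr_rge0//; lra.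
rewrite moment_eq0 ?mulr0// => f g; apply/negP => fg.
case: (rig _ _ _ _ fg odd_st st_le) => -[sE tE].
  by move: nst; rewrite sE tE !eqxx.
by move: ne; rewrite sE tE !eqxx.
Qed.

End sign.

(** * Choice of the coefficients and comparison of the norms *)

Theorem theorem3 (R : realType) (d : nat) (hd : (1 <= d)%N)
  (p : R) (hp : 0 < p)
  (hp2N : forall m : nat, (1 <= m)%N -> p <> (2 * m)%N%:R) :
  exists (k : nat) (a : 'I_d.+1 -> R),
    (1 <= k)%N /\
    (Lp_cube p (fun x : d.-tuple R =>
       1 + \sum_(i < d.+1)
             `|a i|%:C * e (dot (moment_curve d (k + i)%N%:R) x))%R
     < Lp_cube p (fun x : d.-tuple R =>
       1 + \sum_(i < d.+1)
             (a i)%:C * e (dot (moment_curve d (k + i)%N%:R) x))%R)%E.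
Proof.
(* The case i = 0 is excluded by [0 < p], the others by [hp2N]. *)
have qi i : p / 2 != i%:R.
  apply/negP => /eqP pE; have {}pE : p = (2 * i)%N%:R.
    by rewrite natrM -pE mulrC divfK// pnatr_eq0.
  case: i pE => [|i] pE; last exact: (hp2N i.+1).
  by move: hp; rewrite pE muln0 ltxx.
have [k [m [k_gt0 Bm ex rig]]] := extremal_power_sums (Num.bound (p / 2)) hd.
have qm : p / 2 < m%:R.
  apply: lt_le_trans (archi_boundP _) _; first by rewrite divr_ge0// ltW.
  by rewrite ler_nat.
have [c [K [c_gt0 K_ge0 gap]]] := model_mean_gap qi qm ex rig.
have [L L_ge0 approx] := mean_powR_approx d k m.*2.+1 hp.
(* The first bound puts rG in the disc of radius 1/2. The second gives (K + 2L) r < c, so the gap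
   beats its own error and the two approximation errors, at [r] and at [- r]. *)
pose r : R := Num.min (2 * d.+1%:R)^-1 (c / (2 * (K + 2 * L + 1))).
have r_gt0 : 0 < r.
  rewrite lt_min invr_gt0 mulr_gt0// divr_gt0// mulr_gt0//.
  by rewrite ltr_wpDl// addr_ge0// mulr_ge0.
have rd : `|r| * d.+1%:R <= 2^-1.
  rewrite ger0_norm ?(ltW r_gt0)// -ler_pdivlMr// -invfM.
  by rewrite /r ge_min mulrC lexx.
have rd' : `|- r| * d.+1%:R <= 2^-1 by rewrite normrN.
have r1 : r <= 1.
  move: rd; rewrite (ger0_norm (ltW r_gt0)) -natr1 mulrDr mulr1.
  by have := ler0n R d; nra.
have [y [my yJ]] := approx r rd; have [z [mz zJ]] := approx (- r) rd'.
have yz : y < z.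
  have r01 : 0 <= r <= 1 by rewrite (ltW r_gt0).
  have := gap r r01; move: yJ zJ; rewrite normrN (ger0_norm (ltW r_gt0)).
  set X := r ^+ m.*2.+1; rewrite [r ^+ m.*2.+2]exprS -/X.
  have X_gt0 : 0 < X by rewrite exprn_gt0.
  have rc : (K + 2 * L) * r < c.
    have D_gt0 : 0 < K + 2 * L + 1 by rewrite ltr_wpDl// addr_ge0// mulr_ge0.
    have : r <= c / (2 * (K + 2 * L + 1)) by rewrite /r ge_min lexx orbT.
    rewrite ler_pdivlMr ?mulr_gt0//; nra.
  rewrite !ler_distl => /andP[_ yJ] /andP[zJ _] gapr.
  have : (K + 2 * L) * r * X < c * X by rewrite ltr_pM2r.
  move: yJ zJ gapr; set J := model_mean _ _ _ _ r; set J' := model_mean _ _ _ _ (- r).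
  lra.
(* The power 1/p is strictly increasing on nonnegative reals, so the strict inequality of means
   passes to the norms. *)
have y_ge0 : 0 <= y.
  by apply: has_mean_le (has_mean_cst d 0) my _ => x; exact: powR_ge0.
exists k, (fun=> - r); split=> //.
have sumE (b : R) (x : d.-tuple R) :
    \sum_(i < d.+1) b%:C * e (dot (moment_curve d (k + i)%N%:R) x) =
    b%:C * exp_sum k x by rewrite -mulr_sumr.
rewrite /Lp_cube normrN (ger0_norm (ltW r_gt0)).
under eq_integral do rewrite sumE.
under [X in (_ < X `^ _)%E]eq_integral do rewrite sumE.
case: my mz => _ _ -> [_ _ ->]; rewrite !poweR_EFin lte_fin.
by apply: gt0_ltr_powR; rewrite ?nnegrE ?invr_gt0// ltW// (le_lt_trans y_ge0).
Qed.
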